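(* Let $K\subset\mathbb{R}^n$ be a convex body and $j\in\{0,\ldots,n\}$. Then $$\alpha_j(K)\le d_{BM}(K,\mathbb{B}_2^n).$$ Moreover, for every $\beta\in[1,n]$ there exists a convex body $K\subset\mathbb{R}^n$ such that $\alpha_0(K)=d_{BM}(K,\mathbb{B}_2^n)=\beta$.
   Context: A convex body is a compact convex set with nonempty interior. $\mathbb{B}_2^n$ is the closed Euclidean unit ball in $\mathbb{R}^n$. The Banach--Mazur distance of convex bodies $K,L\subset\mathbb{R}^n$ is $d_{BM}(K,L)=\inf\{\lambda>0 : t^1+K\subset A(L)\subset t^2+\lambda K,\ A\in GL(\mathbb{R}^n),\ t^1,t^2\in\mathbb{R}^n\}$. For an affine subspace $U\subset\mathbb{R}^n$, $P_U$ is the orthogonal projection onto $U$ and $\Phi_U(x)=2P_U(x)-x$ is the reflection across $U$. For convex bodies $K,C\subset\mathbb{R}^n$, $R(K,C)=\inf\{\lambda>0 : K\subset z+\lambda C\text{ for some }z\in\mathbb{R}^n\}$. The $j$th Minkowski chirality is $\alpha_j(K)=\inf\{R(K,\Phi_U(K)) : U\subset\mathbb{R}^n\text{ affine subspace},\ \dim U=j\}$. *)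

(* Defs.v *)
From HB Require Import structures.
From mathcomp Require Import all_boot all_order all_algebra.
From mathcomp Require Import all_classical all_reals all_analysis.
Set Implicit Arguments.
Unset Strict Implicit.
Unset Printing Implicit Defensive.
Import Order.TTheory GRing.Theory Num.Theory.
Import numFieldNormedType.Exports.
Local Open Scope classical_set_scope.
Local Open Scope ring_scope.

Section convex_bodies.
Context {R : realType} {n : nat}.
Implicit Types (K L C U : set 'cV[R]_n) (x y t z : 'cV[R]_n).

(* The topology on ['cV[R]_n] is the one of the sup norm, i.e. the usual
   topology of R^n. *)
Definition convex_body K : Prop :=
  [/\ compact K, convex_set (K : set (convex_lmodType 'cV[R]_n))
    & interior K !=set0].

Definition dot x y : R := \sum_(i < n) x i 0 * y i 0.

(* The norm [`|x|] of the library is the sup norm, hence a separate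
   Euclidean norm. *)
Definition enorm x : R := Num.sqrt (dot x x).

Definition eball : set 'cV[R]_n := [set x | enorm x <= 1].

Definition translate t K : set 'cV[R]_n := [set t + x | x in K].

Definition dilate (lambda : R) K : set 'cV[R]_n := [set lambda *: x | x in K].

(* All the sets of reals whose [inf] is taken below are bounded below by 0; they
   are nonempty when the arguments are convex bodies (and [j <= n]), so that the
   default value of [inf] on the empty set plays no role. *)
Definition banach_mazur K L : R :=
  inf [set lambda : R | 0 < lambda /\
    exists (A : 'M[R]_n) (t1 t2 : 'cV[R]_n), [/\ A \in unitmx,
      translate t1 K `<=` [set A *m x | x in L] &
      [set A *m x | x in L] `<=` translate t2 (dilate lambda K)]].

Definition circumradius K C : R :=
  inf [set lambda : R | 0 < lambda /\
    exists z, K `<=` translate z (dilate lambda C)].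

Definition affine_subspace (j : nat) U : Prop :=
  exists (p : 'cV[R]_n) (V : {vspace 'cV[R]_n}),
    \dim V = j /\ U = [set p + v | v in [set` V]].

(* The point y of U such that x - y is orthogonal to (the directions of) U. *)
Definition affine_proj U x : 'cV[R]_n :=
  xget 0 [set y | U y /\ forall z, U z -> dot (x - y) (z - y) = 0].

Definition reflection U x : 'cV[R]_n := 2 *: affine_proj U x - x.

Definition minkowski_chirality (j : nat) K : R :=
  inf [set circumradius K (reflection U @` K) | U in affine_subspace j].

End convex_bodies.

Arguments eball {R} n.

(* Main.v *)
Require Import Defs.
From mathcomp Require Import all_boot all_order all_algebra.
From mathcomp Require Import all_classical all_reals all_analysis.
From mathcomp Require Import complex ring lra.
Import Order.TTheory GRing.Theory Num.Theory.
Import numFieldNormedType.Exports.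
Local Open Scope classical_set_scope.
Local Open Scope ring_scope.

(* If K + t1 is contained in an ellipsoid E = A(B), which is in turn contained
   in t2 + l K, then E is invariant under the reflection Phi across a
   j-dimensional span of its principal axes, so K lies in a translate of
   Phi(E), hence of l Phi(K).

   For the sharpness, the body K is the intersection of beta B with a regular
   simplex circumscribed about B. Since B <= K <= beta B, its distance to B is
   at most beta. Conversely K contains the points - beta a_i, where the a_i are
   the points at which the facets touch B; if K is contained in z - l K, pairing
   - beta a_i with a_i gives <a_i, z> - l <= - beta, and summing over i, with
   sum a_i = 0, yields beta <= l. *)

Set Implicit Arguments.
Unset Strict Implicit.
Unset Printing Implicit Defensive.

(** * Spectral theory of real symmetric matrices *)

Lemma mulmx_trE (R : comPzRingType) m n (w : 'M[R]_(m, n)) (i j : 'I_m) :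
  (w *m w^T) i j = \sum_k w i k * w j k.
Proof. by rewrite mxE; apply: eq_bigr => k _; rewrite mxE. Qed.

Lemma symmetric_eigenvalue_real (R : realType) n (M : 'M[R]_n) (a : R[i])
    (w : 'rV[R[i]]_n) :
  M^T = M -> w != 0 -> w *m map_mx (real_complex R) M = a *: w ->
  a \is Num.real.
Proof.
set MC := map_mx _ M => Msym w0 wM.
pose wc := map_mx Num.conj w.
have MCsym : MC^T = MC by rewrite map_trmx Msym.
have MCconj : map_mx Num.conj MC = MC.
  by apply/matrixP => i j; rewrite !mxE; apply: conjc_real.
have wcM : wc *m MC = a^* *: wc.
  by rewrite /wc -map_mxZ -wM map_mxM MCconj.
have dpos : 0 < (w *m wc^T) 0 0.
  have [k wk] : exists k, w 0 k != 0 by exact/rV0Pn.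
  rewrite mxE (bigD1 k)//= ltr_wpDr//.
    by apply: sumr_ge0 => i _; rewrite !mxE mul_conjC_ge0.
  by rewrite !mxE mul_conjC_gt0.
have : a *: (w *m wc^T) = a^* *: (w *m wc^T).
  rewrite [LHS]scalemxAl -wM [RHS]scalemxAr -[in RHS]linearZ/= -wcM.
  by rewrite trmx_mul MCsym mulmxA.
move=> /matrixP/(_ 0 0); rewrite [LHS]mxE [RHS]mxE => /(mulIf (lt0r_neq0 dpos)).
by rewrite CrealE => <-.
Qed.

(** On the invariant row space of [B], [M] acts through a small matrix [N]. It has a complex
    eigenvalue, which is real because it is also one of [M]; hence it has a real eigenvector [u],
    and [u *m B] is the one sought. *)
Lemma symmetric_eigenvector (R : realType) n r (M : 'M[R]_n) (B : 'M[R]_(r, n)) :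
  M^T = M -> (0 < r)%N -> row_free B -> (B *m M <= B)%MS ->
  exists a (w : 'rV[R]_n), [/\ w != 0, (w <= B)%MS & w *m M = a *: w].
Proof.
move=> Msym r0 Bfree /submxP[N BM].
have [aC] := eigenvalue_closed (map_mx (real_complex R) N) r0.
rewrite eigenvalue_root_char => aroot.
have aCreal : aC \is Num.real.
  move: (aroot); rewrite -eigenvalue_root_char => /eigenvalueP[u uN u0].
  apply: (symmetric_eigenvalue_real (w := u *m map_mx (real_complex R) B) Msym).
    by rewrite mulmx_free_eq0// row_free_map.
  by rewrite -mulmxA -map_mxM BM map_mxM mulmxA uN -scalemxAl.
case: aC aroot aCreal => a b aroot; rewrite complex_real => /eqP b0.
move: aroot; rewrite b0 -map_char_poly.
have -> : (Complex a 0) = real_complex R a by [].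
rewrite fmorph_root -eigenvalue_root_char => /eigenvalueP[u uN u0].
exists a, (u *m B); split.
- by rewrite mulmx_free_eq0.
- exact: submxMl.
- by rewrite -mulmxA BM mulmxA uN -scalemxAl.
Qed.

Lemma mulmx_tr_gt0 (R : realDomainType) n (w : 'rV[R]_n) :
  w != 0 -> 0 < (w *m w^T) 0 0.
Proof.
move=> /rV0Pn[k wk]; rewrite mulmx_trE (bigD1 k)//= ltr_wpDr//.
  by apply: sumr_ge0 => i _; rewrite -expr2 sqr_ge0.
by rewrite -expr2 lt_def sqr_ge0 sqrf_eq0 wk.
Qed.

(* The rows are eigenvectors obtained one at a time in the orthogonal complement
   of the previous ones; that P^T P, the projection onto their span, commutes
   with M is all that matters about them. *)
Lemma orthonormal_invariant_rows (R : realType) n j (M : 'M[R]_n) :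
  M^T = M -> (j <= n)%N ->
  exists P : 'M[R]_(j, n), P *m P^T = 1%:M /\ comm_mx (P^T *m P) M.
Proof.
move=> Msym; elim: j => [_|j IH jn].
  exists 0; rewrite mulmx0; split; first by apply/matrixP=> -[].
  by rewrite /comm_mx mul0mx mulmx0.
have [P [PP PM]] := IH (ltnW jn).
pose B := row_base (kermx P^T).
have rP : \rank P = j.
  apply/eqP; rewrite eqn_leq rank_leq_row -{1}(mxrank1 R j) -PP.
  exact: mxrankM_maxl.
have [|||a [w [w0 wB wM]]] := @symmetric_eigenvector R n _ M B Msym.
- by rewrite mxrank_ker mxrank_tr rP subn_gt0.
- exact: row_base_free.
- have BP : B *m P^T = 0 by apply/sub_kermxP; rewrite eq_row_base.
  rewrite eq_row_base; apply/sub_kermxP.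
  (* The kernel of [P^T] is invariant: [B M P^T = B M (P^T P) P^T = B (P^T P) M P^T = 0]. *)
  rewrite -[LHS]mulmx1 -PP !mulmxA -(mulmxA _ P^T P) -(mulmxA B) -PM.
  by rewrite !mulmxA BP !mul0mx.
have wP : w *m P^T = 0.
  by apply/sub_kermxP; apply: submx_trans wB _; rewrite eq_row_base.
have ww0 := mulmx_tr_gt0 w0.
pose v := (Num.sqrt ((w *m w^T) 0 0))^-1 *: w.
have vM : v *m M = a *: v by rewrite -scalemxAl wM !scalerA mulrC.
have vP : v *m P^T = 0 by rewrite -scalemxAl wP scaler0.
have vv : v *m v^T = 1%:M.
  rewrite -scalemxAl linearZ/= -scalemxAr scalerA -invfM -expr2 sqr_sqrtr ?ltW//.
  by apply/matrixP => i k; rewrite !ord1 [LHS]mxE mulVf ?gt_eqF// [RHS]mxE.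
clearbody v; rewrite -addn1; exists (col_mx P v); split.
  rewrite tr_col_mx mul_col_row PP vP vv -[P *m _]trmxK trmx_mul trmxK vP trmx0.
  by rewrite -scalar_mx_block.
rewrite /comm_mx tr_col_mx mul_row_col mulmxDl mulmxDr PM; congr (_ + _).
rewrite -mulmxA vM mulmxA -{1}Msym -trmx_mul vM -scalemxAr linearZ/=.
by rewrite -scalemxAl.
Qed.

(** * Euclidean inner product, orthogonal projections and reflections *)

Section dot.
Context {R : realType} {n : nat}.
Implicit Types x y z : 'cV[R]_n.

Lemma dotE x y : dot x y = (x^T *m y) 0 0.
Proof. by rewrite mxE; apply: eq_bigr => i _; rewrite mxE. Qed.

Lemma dotC x y : dot x y = dot y x.
Proof. by apply: eq_bigr => i _; rewrite mulrC. Qed.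

Lemma dotDl x y z : dot (x + y) z = dot x z + dot y z.
Proof. by rewrite !dotE linearD mulmxDl mxE. Qed.

Lemma dotZl (a : R) x y : dot (a *: x) y = a * dot x y.
Proof. by rewrite !dotE linearZ/= -scalemxAl mxE. Qed.

Lemma dotDr x y z : dot x (y + z) = dot x y + dot x z.
Proof. by rewrite dotC dotDl !(dotC x). Qed.

Lemma dotZr (a : R) x y : dot x (a *: y) = a * dot x y.
Proof. by rewrite dotC dotZl dotC. Qed.

Lemma dotNl x y : dot (- x) y = - dot x y.
Proof. by rewrite -scaleN1r dotZl mulN1r. Qed.

Lemma dotNr x y : dot x (- y) = - dot x y.
Proof. by rewrite dotC dotNl dotC. Qed.

Lemma dot_ge0 x : 0 <= dot x x.
Proof. by apply: sumr_ge0 => i _; rewrite -expr2 sqr_ge0. Qed.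

Lemma dot_eq0 x : dot x x = 0 -> x = 0.
Proof.
move=> /eqP; rewrite psumr_eq0 => [/allP h|i _]; last by rewrite -expr2 sqr_ge0.
apply/colP => i; have := h i (mem_index_enum _).
by rewrite -expr2 sqrf_eq0 mxE => /eqP.
Qed.

(** Two feet [y] and [z] of the perpendicular coincide, since [z - y = (x - y) - (x - z)] is
    orthogonal to itself. *)
Lemma affine_projE (U : set 'cV[R]_n) x y : U y ->
  (forall z, U z -> dot (x - y) (z - y) = 0) -> affine_proj U x = y.
Proof.
move=> Uy xy; apply: xget_unique => // z [Uz xz].
apply/eqP; rewrite -subr_eq0; apply/eqP/dot_eq0.
have e : z - y = (x - y) - (x - z) by rewrite opprB [RHS]addrC addrA subrK.
by rewrite {1}e dotDl dotNl xy// sub0r -[z - y]opprB dotNr xz// !oppr0.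
Qed.

Lemma reflection_point (p x : 'cV[R]_n) :
  reflection [set p + v | v in [set` (0%VS : {vspace 'cV[R]_n})]] x = 2 *: p - x.
Proof.
rewrite /reflection (@affine_projE _ _ p)//.
  by exists 0; [exact: mem0v|rewrite addr0].
move=> _ [v /= + <-]; rewrite memv0 => /eqP ->.
by rewrite addr0 subrr -(scale0r x) dotZr mul0r.
Qed.

(** [P^T P] is the orthogonal projection onto the span of the orthonormal rows of [P]; this span has
    dimension [j] because [P] is a left inverse of [P^T]. *)
Lemma reflection_rows j (P : 'M[R]_(j, n)) : P *m P^T = 1%:M ->
  exists U : set 'cV[R]_n, affine_subspace j U /\
    forall x, reflection U x = (2 *: (P^T *m P) - 1%:M) *m x.
Proof.
move=> PP; pose f : 'Hom('cV[R]_j, 'cV[R]_n) := linfun (mulmx P^T).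
have fK : cancel f (mulmx P) by move=> u; rewrite lfunE/= mulmxA PP mul1mx.
exists [set 0 + v | v in [set` limg f]]; split.
  exists 0, (limg f); split=> //; rewrite limg_dim_eq; last first.
    have /eqP -> : lker f == 0%VS by apply/lker0P; exact: can_inj fK.
    by rewrite capv0.
  by rewrite dimvf dim_matrix; exact: muln1.
move=> x; rewrite /reflection (@affine_projE _ _ (P^T *m P *m x)).
- by rewrite mulmxBl mul1mx -scalemxAl.
- exists (f (P *m x)); first exact: memv_img (memvf _).
  by rewrite add0r lfunE/= mulmxA.
- move=> _ [v /= /memv_imgP[u _ ->] <-]; rewrite add0r lfunE/=.
  rewrite -mulmxA -mulmxBr dotE (mulmxA _ _ (u - _)) -trmx_mul (mulmxBr P)
    [P *m (P^T *m _)]mulmxA.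
  by rewrite PP mul1mx subrr trmx0 mul0mx mxE.
Qed.

Lemma enormE_le (r : R) x : 0 <= r -> (enorm x <= r) = (dot x x <= r ^+ 2).
Proof.
move=> r0; rewrite /enorm -[X in _ <= X](ger0_norm r0) -sqrtr_sqr.
by rewrite ler_sqrt// sqr_ge0.
Qed.

End dot.

(** * Upper bound of the chirality by the Banach-Mazur distance *)

Lemma inf_ge0 (R : realType) (E : set R) : (forall x, E x -> 0 <= x) -> 0 <= inf E.
Proof.
move=> E0; have [->|/set0P En] := eqVneq E set0; first by rewrite inf0.
exact: lb_le_inf.
Qed.

Section upper_bound.
Context {R : realType} {n : nat}.
Implicit Types K C : set 'cV[R]_n.

Lemma circumradius_ge0 K C : 0 <= circumradius K C.
Proof. by apply: inf_ge0 => l [/ltW]. Qed.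

Lemma circumradius_le K C z (l : R) : 0 < l ->
  K `<=` translate z (dilate l C) -> circumradius K C <= l.
Proof.
move=> l0 KC; apply: ge_inf; first by exists 0 => k [/ltW].
by split=> //; exists z.
Qed.

Lemma minkowski_chirality_le j K U : affine_subspace j U ->
  minkowski_chirality j K <= circumradius K (reflection U @` K).
Proof.
move=> jU; apply: ge_inf; last by exists U.
by exists 0 => _ [V _ <-]; exact: circumradius_ge0.
Qed.

(** With [G] the inverse of [A], the ellipsoid is the set of [y] with [y^T (G^T G) y <= 1]. As
    [G^T G] is the inverse of [A A^T], it commutes with [H], so the orthogonal involution [H]
    preserves the quadratic form. *)
Lemma ellipsoid_invariant (A H : 'M[R]_n) (b : 'cV[R]_n) :
  A \in unitmx -> H^T = H -> H *m H = 1%:M -> comm_mx H (A *m A^T) ->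
  eball n b -> exists2 c, eball n c & A *m b = H *m (A *m c).
Proof.
move=> Au Hsym HH HA; rewrite /eball/= enormE_le// expr1n => b1.
pose G := invmx A.
have GA : G *m A = 1%:M by exact: mulVmx.
have AG : A *m G = 1%:M by exact: mulmxV.
have AGt : A^T *m G^T = 1%:M by rewrite -trmx_mul GA trmx1.
have GAt : G^T *m A^T = 1%:M by rewrite -trmx_mul AG trmx1.
have HG : G^T *m G *m H = H *m (G^T *m G).
  transitivity (G^T *m G *m (H *m (A *m A^T)) *m (G^T *m G)).
    by rewrite -!mulmxA (mulmxA A^T) AGt mul1mx AG mulmx1.
  rewrite HA !mulmxA -(mulmxA G^T G) GA mulmx1 GAt mul1mx.
  by rewrite -!mulmxA.
exists (G *m H *m A *m b); last by rewrite !mulmxA -(mulmxA H A) AG mulmx1 HH mul1mx.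
rewrite /eball/= enormE_le// expr1n; apply: le_trans b1; rewrite !dotE.
suff -> : (G *m H *m A *m b)^T *m (G *m H *m A *m b) = b^T *m b by [].
rewrite !trmx_mul Hsym -!mulmxA (mulmxA H G^T) (mulmxA (H *m G^T)).
rewrite -(mulmxA H G^T) -HG -!mulmxA (mulmxA H H) HH mul1mx.
by rewrite (mulmxA G A) GA mul1mx (mulmxA A^T) AGt mul1mx.
Qed.

Lemma chirality_le_sandwich j K (l : R) (A : 'M[R]_n) (t1 t2 : 'cV[R]_n) :
  (j <= n)%N -> 0 < l -> A \in unitmx ->
  translate t1 K `<=` [set A *m x | x in eball n] ->
  [set A *m x | x in eball n] `<=` translate t2 (dilate l K) ->
  minkowski_chirality j K <= l.
Proof.
move=> jn l0 Au KE EK.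
have Msym : (A *m A^T)^T = A *m A^T by rewrite trmx_mul trmxK.
(* The principal axes of the ellipsoid are eigenvectors of [A A^T]; [U] is spanned by [j] of
   them. *)
have [P [PP PM]] := orthonormal_invariant_rows Msym jn.
have [U [jU refU]] := reflection_rows PP.
apply: le_trans (minkowski_chirality_le _ jU) _.
set H := _ - _ in refU.
have Hsym : H^T = H by rewrite linearB linearZ/= trmx_mul trmxK trmx1.
(* [Q = P^T P] is idempotent, so [(2Q - 1)^2 = 4Q - 4Q + 1]. *)
have HH : H *m H = 1%:M.
  rewrite mulmxBl mul1mx mulmxBr mulmx1 -scalemxAl -scalemxAr.
  rewrite mulmxA -(mulmxA _ P P^T) PP mulmx1 opprB addrA.
  rewrite [_ *: (_ *: _)]scalerA -[2 * 2]/(2 * (1 + 1)) mulrDr mulr1 scalerDl.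
  by rewrite addrK [_ + 1%:M]addrC addrK.
have HM : comm_mx H (A *m A^T).
  apply: comm_mx_sym; apply: comm_mxB; last exact: comm_mx1.
  by rewrite /comm_mx -scalemxAr -scalemxAl PM.
(* The centre comes from [t1 + k = A b = H (A c)] and [A c = t2 + l k'], whence
   [k = (H t2 - t1) + l (H k')]. *)
apply: (@circumradius_le _ _ (H *m t2 - t1)) => // k Kk.
have [|b b1 kb] := KE (t1 + k); first by exists k.
have [c c1 bc] := ellipsoid_invariant Au Hsym HH HM b1.
have [|_ [k' Kk' <-] cK] := EK (A *m c); first by exists c.
exists (l *: (H *m k')).
  by exists (H *m k') => //; exists k' => //; rewrite refU.
by rewrite addrAC scalemxAr -mulmxDr cK -bc kb addrAC subrr add0r.
Qed.

Lemma norm_le_enorm (x : 'cV[R]_n) : `|x| <= enorm x.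
Proof.
rewrite [leLHS]/Num.norm /= mx_normrE; apply/bigmax_leP; split.
  exact: sqrtr_ge0.
move=> [i k] _ /=; rewrite ord1 -sqrtr_sqr ler_wsqrtr//.
rewrite /dot (bigD1 i)//= expr2 lerDl; apply: sumr_ge0 => m _.
by rewrite -expr2 sqr_ge0.
Qed.

Lemma coord_le_norm (x : 'cV[R]_n) i : `|x i 0| <= `|x|.
Proof.
rewrite [leRHS]/Num.norm /= mx_normrE.
by apply/bigmax_geP; right => /=; exists (i, 0).
Qed.

Lemma enorm_le_norm (x : 'cV[R]_n) : enorm x <= n%:R * `|x|.
Proof.
rewrite enormE_le ?mulr_ge0//.
apply: (@le_trans _ _ (\sum_(i < n) `|x| ^+ 2)).
  apply: ler_sum => i _; rewrite -expr2 -real_normK ?num_real//.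
  by rewrite ler_pXn2r ?nnegrE// coord_le_norm.
rewrite sumr_const card_ord exprMn -[leLHS]mulr_natl ler_wpM2r ?sqr_ge0//.
by rewrite -natrX ler_nat; case: (n) => // m; rewrite leq_pmulr.
Qed.

(** Ensures that the infimum defining the distance is over a nonempty set. The ellipsoid is a ball
    of radius [r] around the bounded set [K], and [K] contains a small ball around the interior
    point [p]. *)
Lemma sandwich_exists K : convex_body K ->
  exists l : R, 0 < l /\ exists (A : 'M[R]_n) (t1 t2 : 'cV[R]_n), [/\ A \in unitmx,
      translate t1 K `<=` [set A *m x | x in eball n] &
      [set A *m x | x in eball n] `<=` translate t2 (dilate l K)].
Proof.
move=> [Kc _ [p /nbhs_ballP[e /= e0 pe]]].
have [M [Mr KM]] := compact_bounded Kc.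
have M1 : 0 < `|M| + 1 by rewrite ltr_pwDr.
pose r := n%:R * (`|M| + 1) + 1.
have r0 : 0 < r by rewrite ltr_wpDl// mulr_ge0// ltW.
(* Makes [l * (e / 2) = r]; halving [e] keeps [p + (e / 2) *: b] inside the open ball of radius
   [e]. *)
pose l := 2 * r / e.
have l0 : 0 < l by rewrite divr_gt0// mulr_gt0.
exists l; split => //; exists r%:M, 0, (- (l *: p)); split.
- by rewrite unitmxE det_scalar unitfE expf_neq0// gt_eqF.
- move=> _ [k Kk <-]; rewrite add0r; exists (r^-1 *: k); last first.
    by rewrite mul_scalar_mx scalerA divff ?gt_eqF// scale1r.
  rewrite /eball/= enormE_le// dotZl dotZr mulrA -expr2 exprVn.
  rewrite ler_pdivrMl ?exprn_gt0// expr1n mulr1 -enormE_le; last exact: ltW.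
  apply: le_trans (enorm_le_norm _) _; rewrite /r ler_wpDr// ler_wpM2l//.
  by apply: KM => //; rewrite (le_lt_trans (ler_norm M))// ltrDl.
- move=> _ [b b1 <-]; exists (l *: (p + (e / 2) *: b)).
    exists (p + (e / 2) *: b) => //; apply: pe; rewrite mx_norm_ball /ball_/=.
    rewrite opprD addNKr normrN normrZ gtr0_norm ?divr_gt0//.
    apply: (@le_lt_trans _ _ (e / 2)); last by rewrite ltr_pdivrMr// ltr_pMr// ltr1n.
    rewrite ler_piMr//; first by rewrite divr_ge0// ltW.
    exact: le_trans (norm_le_enorm _) b1.
  rewrite scalerDr addKr scalerA mul_scalar_mx; congr (_ *: _).
  by rewrite /l mulrA divfK ?gt_eqF// mulrC mulrA mulVf ?mul1r// pnatr_eq0.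
Qed.

Lemma chirality_le_banach_mazur j K : convex_body K -> (j <= n)%N ->
  minkowski_chirality j K <= banach_mazur K (eball n).
Proof.
move=> cK jn; apply: lb_le_inf; first exact: sandwich_exists.
move=> l [l0 [A [t1 [t2 [Au KE EK]]]]].
exact: chirality_le_sandwich jn l0 Au KE EK.
Qed.

End upper_bound.

(** * Sharpness: compactness, continuity and the regular simplex *)

Section sharpness.
Context {R : realType}.

Lemma trmx_continuous m n : continuous (@trmx R m n).
Proof.
move=> M S /nbhs_ballP[e e0 eS].
by apply/nbhs_ballP; exists e => //= N [_ MN]; apply: eS; split=> // i j; rewrite !mxE.
Qed.

(** Heine-Borel for row vectors, carried over by transposition. *)
Lemma bounded_closed_compact_cV n (A : set 'cV[R]_n) :
  bounded_set A -> closed A -> compact A.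
Proof.
move=> Ab Ac.
have -> : A = trmx @` (@trmx R 1 n @^-1` A).
  apply/seteqP; split=> [x Ax|_ [x Ax <-]//].
  by exists x^T; rewrite /= trmxK.
apply: continuous_compact.
  exact/continuous_subspaceT/trmx_continuous.
apply: bounded_closed_compact; last first.
  by apply: preimage_closed => // x _; exact: trmx_continuous.
case: Ab => M [Mr MA]; exists M; split => // r Mr' x /= Ax.
apply: le_trans (MA r Mr' _ Ax); rewrite [leLHS]/Num.norm /= mx_normrE.
apply/bigmax_leP; split=> // -[i j] _ /=.
by rewrite ord1; have := coord_le_norm x^T j; rewrite mxE.
Qed.

Lemma dot_continuous n (y : 'cV[R]_n) : continuous (dot y).
Proof.
apply: continuous_big => [|i _ x]; first exact: add_continuous.
by apply: (@continuousM _ _ (fun=> y i 0) (fun M : 'cV[R]_n => M i 0));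
  [exact: cst_continuous|exact: coord_continuous].
Qed.

Lemma dot_self_continuous n : continuous (fun x : 'cV[R]_n => dot x x).
Proof.
apply: continuous_big => [|i _ x]; first exact: add_continuous.
by apply: (@continuousM _ _ (fun M : 'cV[R]_n => M i 0)); exact: coord_continuous.
Qed.

(** One vertex lies on the negative diagonal; the other [n] are scaled basis vectors shifted along
    the diagonal [u]. *)
Lemma regular_simplex n : (0 < n)%N -> exists a : 'I_n.+1 -> 'cV[R]_n,
  [/\ \sum_i a i = 0, forall i, dot (a i) (a i) = 1 &
      forall i j, i != j -> dot (a i) (a j) = - n%:R^-1].
Proof.
move=> n0.
have n0' : n%:R != 0 :> R by rewrite pnatr_eq0 -lt0n.
pose s : R := Num.sqrt n%:R^-1.
pose c : R := Num.sqrt (1 + n%:R^-1).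
have s2 : s ^+ 2 = n%:R^-1 by rewrite sqr_sqrtr// invr_ge0.
have c2 : c ^+ 2 = 1 + n%:R^-1 by rewrite sqr_sqrtr// addr_ge0// invr_ge0.
(* Solves [c + n d = s], which makes the vertices sum to zero. *)
pose d : R := (s - c) / n%:R.
have nd : n%:R * d = s - c by rewrite mulrC divfK.
pose e (k : 'I_n) : 'cV[R]_n := delta_mx k 0.
pose u : 'cV[R]_n := const_mx 1.
have ee j k : dot (e j) (e k) = (j == k)%:R.
  rewrite /dot (bigD1 j)//= !mxE !eqxx/= mul1r andbT big1 ?addr0// => i ij.
  by rewrite !mxE (negbTE ij) mul0r.
have eu k : dot (e k) u = 1.
  rewrite /dot (bigD1 k)//= !mxE !eqxx/= mul1r big1 ?addr0// => i ik.
  by rewrite !mxE (negbTE ik) mul0r.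
have uu : dot u u = n%:R.
  rewrite /dot (eq_bigr (fun=> 1)); last by move=> i _; rewrite !mxE mulr1.
  by rewrite sumr_const card_ord.
pose v k := c *: e k + d *: u.
pose a (i : 'I_n.+1) := if unlift ord0 i is Some k then v k else - s *: u.
have vv j k : dot (v j) (v k) = c ^+ 2 * (j == k)%:R - n%:R^-1.
  rewrite !(dotDl, dotDr, dotZl, dotZr) ee eu (dotC u) eu uu.
  (* The last term is [d (2c + n d) = (s - c)(s + c) / n = (s^2 - c^2) / n = - 1 / n]. *)
  transitivity (c ^+ 2 * (j == k)%:R + d * (2 * c + n%:R * d)); first by ring.
  rewrite nd; congr (_ + _).
  have -> : 2 * c + (s - c) = s + c by ring.
  by rewrite /d mulrAC -subr_sqr s2 c2 opprD addrCA subrr addr0 mulN1r.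
have uv k : dot (- s *: u) (v k) = - n%:R^-1.
  rewrite !(dotDr, dotZl, dotZr) (dotC u) eu uu.
  transitivity (- s * (c + n%:R * d)); first by ring.
  by rewrite nd addrC subrK mulNr -expr2 s2.
have a0 : a ord0 = - s *: u by rewrite /a unlift_none.
have aS k : a (lift ord0 k) = v k by rewrite /a liftK.
exists a; split.
- rewrite big_ord_recl a0 (eq_bigr v) => [|k _]; last exact: aS.
  rewrite big_split/= -scaler_sumr sumr_const card_ord.
  have -> : \sum_i e i = u.
    apply/colP => k; rewrite summxE (bigD1 k)//= !mxE !eqxx big1 ?addr0// => i ik.
    by rewrite !mxE eq_sym (negbTE ik).
  by rewrite -scaler_nat scalerA nd -!scalerDl subrKC addNr scale0r.
- move=> i; case: (unliftP ord0 i) => [k|] ->.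
    by rewrite aS vv eqxx mulr1 c2 addrK.
  by rewrite a0 dotZl dotZr uu mulrA mulrNN -expr2 s2 mulVf.
- move=> i j; case: (unliftP ord0 i) => [k|] ->; case: (unliftP ord0 j) => [l|] ->.
  + by rewrite !aS vv (inj_eq lift_inj) => /negbTE ->; rewrite mulr0 add0r.
  + by rewrite aS a0 dotC uv.
  + by rewrite aS a0 uv.
  + by rewrite eqxx.
Qed.

(** * The simplex truncated by a ball *)

Section truncated_simplex.
Context {n : nat} (a : 'I_n.+1 -> 'cV[R]_n) (beta : R).
Hypotheses (n_gt0 : (0 < n)%N) (beta1 : 1 <= beta) (betan : beta <= n%:R).
Hypotheses (a_sum : \sum_i a i = 0) (a_unit : forall i, dot (a i) (a i) = 1)
  (a_dot : forall i j, i != j -> dot (a i) (a j) = - n%:R^-1).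

Let K := [set x : 'cV[R]_n | dot x x <= beta ^+ 2 /\ forall i, dot (a i) x <= 1].

Let beta0 : 0 < beta. Proof. exact: lt_le_trans beta1. Qed.

Let eball_sub : eball n `<=` K.
Proof.
move=> x; rewrite /eball/= enormE_le// expr1n => x1; split.
  by rewrite (le_trans x1)// expr_ge1// ltW.
(* Expanding the square gives [2 <a_i, x> <= |a_i|^2 + |x|^2 <= 2]. *)
move=> i; have := dot_ge0 (a i - x).
rewrite dotDl !dotDr !(dotNl, dotNr) a_unit (dotC x); lra.
Qed.

Let K_sub (x : 'cV[R]_n) : K x -> eball n (beta^-1 *: x).
Proof.
move=> [xb _]; rewrite /eball/= enormE_le// dotZl dotZr mulrA -expr2 exprVn.
by rewrite ler_pdivrMl ?exprn_gt0// expr1n mulr1.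
Qed.

(** This is where [beta <= n] enters: paired with any other [a_j], the point gives [beta / n]. *)
Let K_vertex i : K (- beta *: a i).
Proof.
split; first by rewrite dotZl dotZr a_unit mulr1 mulrNN expr2.
move=> j; rewrite dotZr; have [->|ji] := eqVneq j i.
  by rewrite a_unit mulr1 lerNl (le_trans _ (ltW beta0))// lerN10.
by rewrite a_dot// mulrNN ler_pdivrMr ?ltr0n// mul1r.
Qed.

Lemma convex_body_truncated_simplex : convex_body K.
Proof.
split.
- apply: bounded_closed_compact_cV.
    exists beta; split; first exact: num_real.
    move=> r br x [xb _]; apply: le_trans (norm_le_enorm x) _.
    by rewrite (le_trans _ (ltW br))// enormE_le// ltW.
  have -> : K = [set x | dot x x <= beta ^+ 2] `&`
      \bigcap_i [set x | dot (a i) x <= 1].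
    by apply/seteqP; split=> x [x1 x2]; split=> // i; [move=> _|]; apply: x2.
  apply: closedI.
    apply: (@preimage_closed _ _ (fun x => dot x x) [set r | r <= beta ^+ 2]).
      by move=> x _; exact: dot_self_continuous.
    exact: closed_le.
  apply: closed_bigI => i _.
  apply: (@preimage_closed _ _ (dot (a i)) [set r | r <= 1]).
    by move=> x _; exact: dot_continuous.
  exact: closed_le.
- move=> x y l; rewrite !inE => -[xb xa] [yb ya].
  have l0 : 0 <= l%:num by [].
  have l1 : l%:num <= 1 by [].
  have -> : conv l x y = l%:num *: (x : 'cV[R]_n) + (1 - l%:num) *: (y : 'cV[R]_n) by [].
  split; last first.
    move=> i; rewrite dotDr !dotZr; have := xa i; have := ya i; nra.
  have l1' : 0 <= 1 - l%:num by rewrite subr_ge0.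
  (* [l (1 - l) |x - y|^2] is the convexity defect of the squared norm. *)
  have := mulr_ge0 (mulr_ge0 l0 l1') (dot_ge0 ((x : 'cV[R]_n) - y)).
  rewrite !(dotDl, dotDr, dotZl, dotZr, dotNl, dotNr) (dotC y x).
  move: (ler_wpM2l l0 xb) (ler_wpM2l l1' yb).
  set p := dot x x; set q := dot y y; set t := dot x y; lra.
(* The Euclidean norm is at most [n] times the sup norm, so the sup ball of radius [1 / n] lies in
   the unit ball. *)
- exists 0; apply/nbhs_ballP; exists n%:R^-1 => /=; first by rewrite invr_gt0 ltr0n.
  move=> x; rewrite mx_norm_ball /ball_/= sub0r normrN => xn.
  apply: eball_sub; rewrite /eball/= (le_trans (enorm_le_norm x))//.
  by rewrite -ler_pdivlMl ?ltr0n// mulr1 ltW.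
Qed.

Lemma banach_mazur_truncated_simplex_le : banach_mazur K (eball n) <= beta.
Proof.
apply: ge_inf; first by exists 0 => l [/ltW].
split => //; exists beta%:M, 0, 0; split.
- by rewrite unitmxE det_scalar unitfE expf_neq0// gt_eqF.
- move=> _ [k /K_sub Kk <-]; rewrite add0r; exists (beta^-1 *: k) => //.
  by rewrite mul_scalar_mx scalerA divff ?gt_eqF// scale1r.
- move=> _ [b /eball_sub Kb <-]; exists (beta *: b); first by exists b.
  by rewrite add0r mul_scalar_mx.
Qed.

Lemma chirality_truncated_simplex_ge : beta <= minkowski_chirality 0 K.
Proof.
apply: lb_le_inf.
  exists (circumradius K (reflection [set 0 + v | v in [set` 0%VS]] @` K)).
  by eexists; last reflexivity; exists 0, 0%VS; rewrite dimv0.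
(* A zero-dimensional [U] is a point [p], and its reflection is [x] to [2p - x]. *)
move=> _ [_ [p [V [/eqP + ->]]] <-]; rewrite dimv_eq0 => /eqP ->.
apply: lb_le_inf.
  (* Feasibility of [beta] rules out the default value of [inf]: [k / beta] lies in the unit ball,
     so its opposite lies in [K], and the centre cancels the shift by [2p]. *)
  exists beta; split => //; exists (- beta *: (2 *: p)) => k /K_sub Kk.
  exists (beta *: (2 *: p + beta^-1 *: k)).
    exists (2 *: p + beta^-1 *: k) => //; exists (- (beta^-1 *: k)).
      apply: eball_sub; move: Kk; rewrite /eball/= !enormE_le//.
      by rewrite dotNl dotNr opprK.
    by rewrite reflection_point opprK.
  by rewrite scalerDr scaleNr addKr scalerA divff ?gt_eqF// scale1r.
move=> l [l0 [z Kz]].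
(* The shift [2 l p] of the reflected body joins [z], so the pairing argument works for every
   [p]. *)
have h i : dot (a i) (z + l *: (2 *: p)) - l <= - beta.
  have [_ [_ [x Kx <-] <-] zx] := Kz _ (K_vertex i).
  move: zx; rewrite reflection_point => /(congr1 (dot (a i))).
  rewrite !(dotDr, dotZr, dotNr) a_unit mulr1 => <-.
  have := Kx.2 i; nra.
have : \sum_(i < n.+1) (dot (a i) (z + l *: (2 *: p)) - l) <= \sum_(i < n.+1) - beta.
  by apply: ler_sum => i _; exact: h.
rewrite big_split/=.
have -> : \sum_(i < n.+1) dot (a i) (z + l *: (2 *: p)) = 0.
  transitivity (dot (\sum_i a i) (z + l *: (2 *: p))).
    apply: esym; apply: (big_morph (fun x => dot x _)) => [x y|].
      exact: dotDl.
    by rewrite -(scale0r 0) dotZl mul0r.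
  by rewrite a_sum -(scale0r 0) dotZl mul0r.
by rewrite add0r !sumr_const card_ord lerMn2r/= lerN2.
Qed.

End truncated_simplex.
End sharpness.

Theorem theorem4p2 (R : realType) (n : nat) :
  (forall (K : set 'cV[R]_n) (j : nat), convex_body K -> (j <= n)%N ->
     minkowski_chirality j K <= banach_mazur K (eball n)) /\
  (forall beta : R, 1 <= beta <= n%:R ->
     exists K : set 'cV[R]_n, [/\ convex_body K,
       minkowski_chirality 0 K = banach_mazur K (eball n) &
       banach_mazur K (eball n) = beta]).
Proof.
split=> [K j|beta /andP[beta1 betan]]; first exact: chirality_le_banach_mazur.
have n0 : (0 < n)%N.
  by rewrite -(ltr0n R) (lt_le_trans ltr01)// (le_trans beta1).
have [a [a_sum a_unit a_dot]] := @regular_simplex R n n0.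
set K := [set x : 'cV[R]_n | dot x x <= beta ^+ 2 /\ forall i, dot (a i) x <= 1].
have cK : convex_body K by exact: convex_body_truncated_simplex.
have h1 : beta <= minkowski_chirality 0 K by exact: chirality_truncated_simplex_ge.
have h2 := chirality_le_banach_mazur cK (leq0n n).
have h3 : banach_mazur K (eball n) <= beta by exact: banach_mazur_truncated_simplex_le.
exists K; split => //; apply/eqP; rewrite eq_le.
  by rewrite h2 (le_trans h3 h1).
by rewrite h3 (le_trans h1 h2).
Qed.
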